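(* Let $\Gamma$ be a general network and let $\delta$ be the congruence on $\mathcal{L}(\Gamma)$ with $(l_1,l_2)\in\delta$ if and only if $P_1=P_2$, where $l_1=\oplus(P_1|S_1)$ and $l_2=\oplus(P_2|S_2)$. Then each $\delta$-class of $\mathcal{L}(\Gamma)$ is a sub-semilattice of $\mathcal{L}(\Gamma)$ with respect to $\mathring{\cup}$.
   Context: A general network $\Gamma$ has a finite vertex set $\Gamma^0$ and a finite set $T$ of tensors. A tensor $t=T_A^B$ is given by a non-empty set $A\subseteq\Gamma^0$ of covariant indexes and a (possibly empty) set $B\subseteq\Gamma^0$ of contra-variant indexes; its index set is $I(t)=A\cup B$. A 2-chain is an unordered pair $\oplus(t_i,t_j)$ of distinct tensors $t_i,t_j\in T$ with $I(t_i)\cap I(t_j)\neq\emptyset$. A (non-empty) tensor chain is $\oplus(P|S)$, where $P\subseteq T$ is non-empty, $S$ is a set of 2-chains between elements of $P$, and the pair is connected: any two distinct $t_i,t_j\in P$ are joined by a sequence $t_i=t_{k_1},\dots,t_{k_m}=t_j$ in $P$ with $\oplus(t_{k_\ell},t_{k_{\ell+1}})\in S$ for all $1\le \ell<m$. A tensor chain is determined by $(P,S)$; a single tensor $t$ is the chain with $P=\{t\}$, $S=\varnothing$. $\mathcal{L}(\Gamma)$ is the set of all non-empty tensor chains together with an extra element $\emptyset$ (the empty relation), whose tensor set is regarded as empty. Reducing: for non-empty chains $l_1=\oplus(P_1|S_1)$, $l_2=\oplus(P_2|S_2)$, put $l_1\mathring{\cup}l_2=\oplus(P_1\cup P_2|S_1\cup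 S_2)$ if $P_1\cap P_2\neq\varnothing$ and $l_1\mathring{\cup}l_2=\emptyset$ otherwise; also $\emptyset\mathring{\cup}l=l\mathring{\cup}\emptyset=\emptyset$ for all $l$. A semilattice is an idempotent commutative semigroup. A non-empty subset $H$ of $\mathcal{L}(\Gamma)$ is a sub-semilattice of $\mathcal{L}(\Gamma)$ if $H$ forms a semilattice under $\mathring{\cup}$ (in particular it is closed under $\mathring{\cup}$). *)

(* Defs.v *)
From mathcomp Require Import all_boot.

Set Implicit Arguments.
Unset Strict Implicit.
Unset Printing Implicit Defensive.

(* The tensors form a finite type rather than a set of pairs (A, B), so that
   two different tensors may carry the same index sets. *)
Record network := Network {
  vertex : finType;
  tensor : finType;
  covariant : tensor -> {set vertex};
  contravariant : tensor -> {set vertex};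
  covariant_neq0 : forall t, covariant t != set0
}.

Section Chains.

Variable G : network.
Implicit Types (P : {set tensor G}) (S : {set {set tensor G}}).

Definition index_set (t : tensor G) : {set vertex G} :=
  covariant t :|: contravariant t.

Definition two_chain (e : {set tensor G}) : bool :=
  [exists ti, exists tj, [&& ti != tj, e == [set ti; tj]
                           & index_set ti :&: index_set tj != set0]].

Definition linked P S : rel (tensor G) :=
  [rel ti tj | [&& ti \in P, tj \in P & [set ti; tj] \in S]].

Definition is_chain P S : bool :=
  [&& P != set0,
      [forall e in S, two_chain e && (e \subset P)]
    & [forall ti in P, forall tj in P,
         (ti != tj) ==> connect (linked P S) ti tj]].

Definition chain : Type :=
  {PS : {set tensor G} * {set {set tensor G}} | is_chain PS.1 PS.2}.

Definition chain_tensors (l : chain) : {set tensor G} := (val l).1.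
Definition chain_links (l : chain) : {set {set tensor G}} := (val l).2.

(* None is the empty relation. *)
Definition chains : Type := option chain.

Definition tensors (l : chains) : {set tensor G} :=
  if l is Some c then chain_tensors c else set0.

Lemma is_chainU P1 S1 P2 S2 :
  is_chain P1 S1 -> is_chain P2 S2 -> P1 :&: P2 != set0 ->
  is_chain (P1 :|: P2) (S1 :|: S2).
Proof.
move=> /and3P[P1n0 S1P C1] /and3P[_ S2P C2] /set0Pn[t /setIP[t1 t2]].
have con P S P' S' x y : P \subset P' -> S \subset S' ->
    [forall ti in P, forall tj in P, (ti != tj) ==> connect (linked P S) ti tj] ->
    x \in P -> y \in P -> connect (linked P' S') x y.
  move=> sP sS /forall_inP C xP yP.
  have [->|xy] := eqVneq x y; first exact: connect0.
  have /forall_inP/(_ y yP) := C x xP; rewrite xy /=.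
  apply: connect_sub => u v /and3P[uP vP uv]; apply: connect1.
  by rewrite /linked /= (subsetP sP _ uP) (subsetP sP _ vP) (subsetP sS _ uv).
have hub x : x \in P1 :|: P2 ->
    connect (linked (P1 :|: P2) (S1 :|: S2)) x t /\
    connect (linked (P1 :|: P2) (S1 :|: S2)) t x.
  case/setUP => xP; split.
  - exact: (con P1 S1) (subsetUl _ _) (subsetUl _ _) C1 xP t1.
  - exact: (con P1 S1) (subsetUl _ _) (subsetUl _ _) C1 t1 xP.
  - exact: (con P2 S2) (subsetUr _ _) (subsetUr _ _) C2 xP t2.
  - exact: (con P2 S2) (subsetUr _ _) (subsetUr _ _) C2 t2 xP.
apply/and3P; split.
- by apply/set0Pn; exists t; rewrite inE t1.
- apply/forall_inP => e /setUP[eS|eS].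
  + have /andP[-> eP] := forall_inP S1P e eS.
    exact: subset_trans eP (subsetUl _ _).
  + have /andP[-> eP] := forall_inP S2P e eS.
    exact: subset_trans eP (subsetUr _ _).
- apply/forall_inP => x xP; apply/forall_inP => y yP; apply/implyP => _.
  exact: connect_trans (hub x xP).1 (hub y yP).2.
Qed.

Definition chainU (l1 l2 : chain)
    (h : chain_tensors l1 :&: chain_tensors l2 != set0) : chain :=
  exist _ (chain_tensors l1 :|: chain_tensors l2,
           chain_links l1 :|: chain_links l2)
          (is_chainU (valP l1) (valP l2) h).

Definition reduce (l1 l2 : chains) : chains :=
  match l1, l2 with
  | Some c1, Some c2 =>
    if @idP (chain_tensors c1 :&: chain_tensors c2 != set0) is ReflectT h
    then Some (chainU h) else None
  | _, _ => None
  end.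

End Chains.

Record congruence (X : Type) (op : X -> X -> X) := Congruence {
  congruence_rel :> rel X;
  congruence_equiv : equivalence_rel congruence_rel;
  congruence_op : forall x x' y y',
    congruence_rel x x' -> congruence_rel y y' ->
    congruence_rel (op x y) (op x' y')
}.

Definition classes (X : finType) (op : X -> X -> X) (r : congruence op) :
  {set {set X}} := equivalence_partition r [set: X].

Definition sub_semilattice (X : finType) (op : X -> X -> X) (H : {set X}) :
    Prop :=
  [/\ H != set0,
      {in H &, forall x y, op x y \in H},
      {in H & &, associative op},
      {in H &, commutative op}
    & {in H, forall x, op x x = x}].

Lemma tensors_reduce (G : network) (l1 l2 : chains G) :
  tensors (reduce l1 l2) =
  if tensors l1 :&: tensors l2 != set0 then tensors l1 :|: tensors l2
  else set0.
Proof.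
case: l1 l2 => [c1|] [c2|] /=; rewrite ?set0I ?setI0 ?eqxx //.
case: {-}_ / idP => [h|h]; first by rewrite h.
by move/negP/negbTE: h => ->.
Qed.

Section Delta.

Variable G : network.

Definition same_tensors (l1 l2 : chains G) : bool := tensors l1 == tensors l2.

Lemma same_tensors_equiv : equivalence_rel same_tensors.
Proof. by rewrite /same_tensors => x y z; split; [exact: eqxx | move/eqP->]. Qed.

Lemma same_tensors_reduce x x' y y' :
  same_tensors x x' -> same_tensors y y' ->
  same_tensors (reduce x y) (reduce x' y').
Proof.
rewrite /same_tensors => /eqP xx' /eqP yy'.
by rewrite !tensors_reduce xx' yy'.
Qed.

Definition delta : congruence (@reduce G) :=
  Congruence same_tensors_equiv same_tensors_reduce.

End Delta.

(* Main.v *)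
Require Import Defs.
From mathcomp Require Import all_boot.

(** Inside a delta-class the tensor set is constant, and a relation is determined
    by its tensor set and its set of 2-chains.  Two non-empty chains of the same
    class always share a tensor, so there reducing is just the union of the sets
    of 2-chains, and it inherits the semilattice laws of the union. *)

(** The value [set0] at [None] lets the union law for links hold in the class of the empty relation
    too. *)
Definition links {G : network} (l : chains G) : {set {set tensor G}} :=
  if l is Some c then chain_links c else set0.

Lemma chain_tensors_neq0 {G : network} (c : chain G) :
  chain_tensors c != set0.
Proof. by case/and3P: (valP c). Qed.

(** The chain condition is boolean, so its proof carries no data; [None] is told apart from a chain
    by its empty tensor set. *)
Lemma tensors_links_inj (G : network) (l1 l2 : chains G) :
  tensors l1 = tensors l2 -> links l1 = links l2 -> l1 = l2.
Proof.
case: l1 l2 => [c1|] [c2|] //= eqP eqS.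
- by congr Some; apply: val_inj; apply: injective_projections.
- by have := chain_tensors_neq0 c1; rewrite eqP eqxx.
- by have := chain_tensors_neq0 c2; rewrite -eqP eqxx.
Qed.

Lemma tensors_reduce_same (G : network) (l1 l2 : chains G) :
  tensors l1 = tensors l2 -> tensors (reduce l1 l2) = tensors l1.
Proof.
(* If the common tensor set is empty, the default [set0] is that very set. *)
by move=> eqP; rewrite tensors_reduce -eqP setIid setUid; case: eqVneq => [->|].
Qed.

Lemma links_reduce_same (G : network) (l1 l2 : chains G) :
  tensors l1 = tensors l2 ->
  links (reduce l1 l2) = links l1 :|: links l2.
Proof.
case: l1 l2 => [c1|] [c2|] //= eqP.
(* The [None] branch would need the common, non-empty tensor set to be disjoint from itself. *)
- case: {-}_ / idP => // /negP.
  by rewrite -eqP setIid chain_tensors_neq0.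
- by have := chain_tensors_neq0 c1; rewrite eqP eqxx.
- by have := chain_tensors_neq0 c2; rewrite -eqP eqxx.
- by rewrite setU0.
Qed.

Theorem proposition3p5 (G : network) (H : {set chains G}) :
  H \in classes (delta G) -> sub_semilattice (@reduce G) H.
Proof.
case/imsetP=> l _ ->.
set D := [set y in _ | _].
have inD x : (x \in D) = (tensors l == tensors x) by rewrite !inE.
have same x y : x \in D -> y \in D -> tensors x = tensors y.
  by rewrite !inD => /eqP <- /eqP <-.
have closed : {in D &, forall x y, reduce x y \in D}.
  move=> x y xD yD; rewrite inD tensors_reduce_same; last exact: same.
  by rewrite -inD.
have links_reduce : {in D &, forall x y, links (reduce x y) = links x :|: links y}.
  by move=> x y xD yD; apply: links_reduce_same; apply: same.
have eqD x y : x \in D -> y \in D -> links x = links y -> x = y.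
  by move=> xD yD; apply: tensors_links_inj; apply: same.
split=> //.
- by apply/set0Pn; exists l; rewrite inD.
- by move=> x y z *; apply: eqD; rewrite ?links_reduce ?closed // setUA.
- by move=> x y *; apply: eqD; rewrite ?links_reduce ?closed // setUC.
- by move=> x *; apply: eqD; rewrite ?links_reduce ?closed // setUid.
Qed.
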